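(* Let $R$ be a principal ideal domain that is not a field. Let $U(R)$ be its group of units, let $\mathcal{P}_R$ be the set of associate classes of prime elements of $R$, and let $M(R)$ be the Macías space over $R$. The following are equivalent: (a) $U(R)$ is not open in $M(R)$. (b) The set of prime elements of $R$ is dense in $M(R)$. (c) The set $\mathcal{P}_R$ is infinite (that is, $R$ has infinitely many pairwise non-associate prime elements). (d) $R$ is semiprimitive.
   Context: For a commutative integral domain $R$ with $1 \neq 0$, write $R^0 = R \setminus \{0\}$. For $k \in R^0$ let $\sigma_k^0 := \{s \in R^0 : \langle k \rangle + \langle s \rangle = R\}$, where $\langle k \rangle$ is the principal ideal generated by $k$. The sets $\sigma_k^0$ ($k \in R^0$) form a basis of a topology on $R^0$; the Macías space $M(R)$ is the set $R^0$ with this topology. Two elements $a,b \in R$ are associates if $a = ub$ for some unit $u$ of $R$. The Jacobson radical $\mathfrak{J}(R)$ is the intersection of all maximal ideals of $R$, and $R$ is semiprimitive if $\mathfrak{J}(R) = \{0\}$. *)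

(* Defs.v *)
From HB Require Import structures.
From mathcomp Require Import all_boot all_algebra.
From mathcomp Require Import boolp classical_sets functions cardinality topology.

Set Implicit Arguments.
Unset Strict Implicit.
Unset Printing Implicit Defensive.

Import GRing.Theory.

Local Open Scope classical_set_scope.
Local Open Scope ring_scope.

Section Ideals.
Context {R : idomainType}.

(* MathComp's [idealr_closed] also requires [1 \notin I]; here the improper
   ideal is allowed. *)
Definition ideal (I : set R) : Prop :=
  [/\ I 0, forall x y, I x -> I y -> I (x + y) & forall a x, I x -> I (a * x)].

Definition principal_ideal (k : R) : set R := range (fun a => a * k).

Definition ideal_sum (I J : set R) : set R := [set x + y | x in I & y in J].

Definition maximal_ideal (M : set R) : Prop :=
  [/\ ideal M, M <> setT &
      forall J, ideal J -> M `<=` J -> J = M \/ J = setT].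

Definition divides (a b : R) : Prop := exists c, b = c * a.

Definition associates (a b : R) : Prop :=
  exists u, u \is a GRing.unit /\ a = u * b.

Definition associate_class (a : R) : set R := [set b | associates b a].

Definition prime_element (p : R) : Prop :=
  [/\ p != 0, p \isn't a GRing.unit &
      forall a b, divides p (a * b) -> divides p a \/ divides p b].

End Ideals.

(* The domain hypothesis is carried by [idomainType]. *)
Definition is_pid (R : idomainType) : Prop :=
  forall I : set R, ideal I -> exists k, I = principal_ideal k.

Definition prime_classes (R : idomainType) : set (set R) :=
  associate_class @` [set p : R | prime_element p].
Arguments prime_classes R : clear implicits.

Definition jacobson_radical (R : idomainType) : set R :=
  \bigcap_(M in [set M : set R | maximal_ideal M]) M.
Arguments jacobson_radical R : clear implicits.

Definition semiprimitive (R : idomainType) : Prop :=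
  jacobson_radical R = [set 0].

Definition macias (R : idomainType) : Type := {x : R | x != 0}.

HB.instance Definition _ (R : idomainType) := Choice.on (macias R).

Section MaciasTopology.
Context {R : idomainType}.

Definition macias_basic (k : macias R) : set (macias R) :=
  [set s | ideal_sum (principal_ideal (val k)) (principal_ideal (val s)) = setT].

Lemma macias_basicP (k s : macias R) :
  macias_basic k s <-> exists a b, a * val k + b * val s = 1.
Proof.
split=> [ks|[a [b e]]].
  have : [set: R] 1 by [].
  by rewrite -ks => -[_ [a _ <-]] [_ [b _ <-]] <-; exists a, b.
apply/seteqP; split=> // x _.
exists (x * a * val k); first by exists (x * a).
exists (x * b * val s); first by exists (x * b).
by rewrite -!mulrA -mulrDr e mulr1.
Qed.

(* [isBaseTopological] wants a pointed index type. *)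
Definition macias1 : macias R := exist _ 1 (oner_neq0 R).
HB.instance Definition _ := isPointed.Build (macias R) macias1.

Lemma macias_basic_cover : \bigcup_(k in setT) macias_basic k = setT.
Proof.
apply/seteqP; split=> // s _; exists macias1 => //.
by apply/macias_basicP; exists 1, 0; rewrite mul0r addr0 mulr1.
Qed.

Lemma macias_basic_join (i j t : macias R) : setT i -> setT j ->
  macias_basic i t -> macias_basic j t ->
  exists k, [/\ setT k, macias_basic k t
              & macias_basic k `<=` macias_basic i `&` macias_basic j].
Proof.
move=> _ _ /macias_basicP[a [b e]] /macias_basicP[c [d f]].
exists (exist _ (val i * val j) (mulf_neq0 (valP i) (valP j))); split=> //.
  apply/macias_basicP; exists (a * c), (b + a * val i * d).
  rewrite /= -[RHS]e -[in RHS](mulr1 (a * val i)) -f mulrDr mulrDl !mulrA.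
  by rewrite (mulrAC a c) addrCA addrC.
move=> s /macias_basicP[u [v /= g]].
by split; apply/macias_basicP;
  [exists (u * val j) | exists (u * val i)]; exists v;
  rewrite -g mulrA ?(mulrAC u (val j)).
Qed.

HB.instance Definition _ := isBaseTopological.Build (macias R)
  macias_basic_cover macias_basic_join.

Lemma macias_openE (A : set (macias R)) :
  open A <-> exists K : set (macias R), A = \bigcup_(k in K) macias_basic k.
Proof.
by split=> [[K _ <-]|[K ->]]; exists K.
Qed.

End MaciasTopology.

(* Main.v *)
(* In a principal ideal domain the nonzero primes generate maximal ideals and
   every nonzero nonunit has a prime divisor. Hence a prime lies in the basic
   open set of [k] iff it does not divide [k], and that set consists of units
   only iff every prime divides [k]. The existence of such a nonzero [k] is the
   negation of each of the four conditions: a product of representatives of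
   finitely many classes is such a [k], and conversely a nonzero [k] has only
   finitely many classes of prime divisors. *)

Require Import Defs.
From mathcomp Require Import all_boot all_algebra.
From mathcomp Require Import boolp classical_sets functions cardinality topology.

Import GRing.Theory.

Local Open Scope classical_set_scope.
Local Open Scope ring_scope.

(** * Ideals and divisibility in an integral domain *)

Section Ideals.
Set Implicit Arguments.
Unset Strict Implicit.
Context {R : idomainType}.
Implicit Types (a b k p x y : R) (I J M : set R).

Lemma principal_idealP k x : principal_ideal k x <-> divides k x.
Proof. by split=> [[a _ <-]|[a ->]]; exists a. Qed.

Lemma principal_ideal_self k : principal_ideal k k.
Proof. by exists 1; rewrite ?mul1r. Qed.

Lemma principal_ideal_ideal k : ideal (principal_ideal k).
Proof.
split; first by exists 0; rewrite ?mul0r.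
  by move=> _ _ [a _ <-] [b _ <-]; exists (a + b); rewrite ?mulrDl.
by move=> a _ [b _ <-]; exists (a * b); rewrite ?mulrA.
Qed.

Lemma principal_ideal_sub I k : ideal I -> I k -> principal_ideal k `<=` I.
Proof. by move=> [_ _ IM] Ik _ [a _ <-]; exact: IM. Qed.

Lemma ideal_one I : ideal I -> I 1 -> I = setT.
Proof.
move=> [_ _ IM] I1; apply/seteqP; split=> // x _.
by rewrite -[x]mulr1; exact: IM.
Qed.

Lemma divides_unit x y : divides x y -> y \is a GRing.unit -> x \is a GRing.unit.
Proof. by move=> [c ->]; rewrite unitrM => /andP[]. Qed.

Lemma ideal_sum_ideal I J : ideal I -> ideal J -> ideal (ideal_sum I J).
Proof.
move=> [I0 ID IM] [J0 JD JM]; split.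
- by exists 0 => //; exists 0 => //; rewrite addr0.
- move=> _ _ [x Ix [y Jy <-]] [x' Ix' [y' Jy' <-]].
  exists (x + x'); first exact: ID.
  by exists (y + y'); [exact: JD|rewrite addrACA].
- move=> a _ [x Ix [y Jy <-]].
  exists (a * x); first exact: IM.
  by exists (a * y); [exact: JM|rewrite mulrDr].
Qed.

(** The ideal [M + (x)] contains [M] and also [x], so by maximality it is the whole ring. *)
Lemma maximal_ideal_coprime M x : maximal_ideal M -> ~ M x ->
  exists m a, M m /\ m + a * x = 1.
Proof.
move=> [iM _ maxM] Mx.
have /maxM[||e] := ideal_sum_ideal iM (principal_ideal_ideal x).
- move=> m Mm; exists m => //; exists 0; last by rewrite addr0.
  by exists 0; rewrite ?mul0r.
- move=> e; case: Mx; rewrite -e; have [I0 _ _] := iM.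
  exists 0 => //; exists x; last by rewrite add0r.
  exact: principal_ideal_self.
- have : [set: R] 1 by [].
  by rewrite -e => -[m Mm [_ [a _ <-] eq1]]; exists m, a.
Qed.

Lemma prime_class_divides p q x : associate_class p = associate_class q ->
  divides q x -> divides p x.
Proof.
move=> e [c ->]; have : associate_class p q.
  by rewrite e; exists 1; rewrite unitr1 mul1r.
by move=> [u [_ ->]]; exists (c * u); rewrite mulrA.
Qed.

(** In [q = c * p] the prime [q] divides [c] or [p]. The first would make [p] a unit, and the second
    makes [c] a unit. *)
Lemma prime_divides_prime p q : prime_element p -> prime_element q ->
  divides p q -> associate_class p = associate_class q.
Proof.
move=> [p0 pU _] [q0 qU qP] [c e].
have cU : c \is a GRing.unit.
  have [|[d cd]|qp] := qP c p; first by exists 1; rewrite mul1r.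
  - case/negP: pU; apply/unitrP; exists d.
    have : q * (d * p) = q * 1 by rewrite mulr1 mulrCA mulrA -cd -e.
    by move/(mulfI q0) => dp; rewrite mulrC [p * d]mulrC.
  - have [d pd] := qp; have : p * (d * c) = p * 1.
      by rewrite mulr1 mulrC -mulrA -e -pd.
    by move/(mulfI p0)=> dc; apply/unitrP; exists d; rewrite [c * d]mulrC.
apply/seteqP; split=> x [u [uU ->]].
  by exists (u / c); rewrite unitrM uU unitrV cU e mulrA divrK.
by exists (u * c); rewrite unitrM uU cU e mulrA.
Qed.

(* A generator of the union of a chain of ideals already lies in one of its
   members, so Zorn's lemma applies to every family of ideals; the empty set is
   added to the family only to bound the empty chain. *)
Lemma pid_maximal_member (F : set (set R)) : is_pid R ->
  F `<=` ideal -> F !=set0 ->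
  exists I, F I /\ forall J, F J -> I `<=` J -> J = I.
Proof.
move=> pidR Fid [I0 FI0].
pose P : set (set R) := [set A | A = set0 \/ F A].
have [C CP tC|A [PA maxA]] := @Zorn_bigcup R P.
  have [[B [CB FB]]|nF] := pselect (exists B, C B /\ F B); last first.
    left; apply/seteqP; split=> // x [B CB Bx].
    have [B0|FB] := CP _ CB; first by rewrite B0 in Bx.
    by case: nF; exists B.
  have idU : ideal (\bigcup_(A in C) A).
    split.
    - by exists B => //; have [] := Fid _ FB.
    - move=> x y [X CX Xx] [Y CY Yy].
      (* Two members of the chain are comparable, and the larger one contains both summands. *)
      wlog XY : x y X Y CX CY Xx Yy / X `<=` Y.
        move=> H; have [XY|YX] := tC _ _ CX CY; first exact: (H x y X Y).
        by rewrite addrC; exact: (H y x Y X).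
      exists Y => //; have [Y0|/Fid[_ D _]] := CP _ CY.
        by rewrite Y0 in Yy.
      by apply: D => //; exact: XY.
    - move=> a x [X CX Xx]; exists X => //; have [X0|/Fid[_ _ D]] := CP _ CX.
        by rewrite X0 in Xx.
      exact: D.
  have [k Uk] := pidR _ idU.
  have : (\bigcup_(A in C) A) k by rewrite Uk; exact: principal_ideal_self.
  move=> [A CA Ak]; right; have [A0|FA] := CP _ CA; first by rewrite A0 in Ak.
  suff -> : \bigcup_(A in C) A = A by [].
  apply/seteqP; split; last by move=> x Ax; exists A.
  by rewrite Uk; apply: principal_ideal_sub => //; exact: Fid.
have FA : F A.
  (* The maximal set is not the added empty set, since [I0] contains 0 and is strictly larger. *)
  case: PA => // A0; case: (maxA I0); last by right.
  rewrite A0; split=> // I0sub.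
  by have [z _ _] := Fid _ FI0; exact: (I0sub 0).
exists A; split=> // J FJ AJ; apply/seteqP; split=> //.
apply: contrapT => nJA; apply: (maxA J); last by right.
by split.
Qed.

End Ideals.

(** * Prime divisors in a principal ideal domain *)

Section PrincipalIdealDomain.
Set Implicit Arguments.
Unset Strict Implicit.
Context {R : idomainType} (pidR : is_pid R).
Implicit Types (k p x y : R).

(** A largest proper ideal containing [x] is a maximal ideal. Its generator divides [x] and is
    prime. *)
Lemma pid_prime_divisor x : x != 0 -> x \isn't a GRing.unit ->
  exists p, prime_element p /\ divides p x.
Proof.
move=> x0 xU.
pose F := [set I : set R | [/\ ideal I, I x & ~ I 1]].
have [||M [[iM Mx M1] maxM]] := @pid_maximal_member R F pidR.
- by move=> I [].
- exists (principal_ideal x); split; first exact: principal_ideal_ideal.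
    exact: principal_ideal_self.
  by move=> /principal_idealP /divides_unit; rewrite unitr1 (negbTE xU) => /(_ isT).
have maximalM : maximal_ideal M.
  split=> // [MT|J iJ MJ]; first by apply: M1; rewrite MT.
  have [J1|nJ1] := pselect (J 1); first by right; exact: ideal_one.
  by left; apply: maxM => //; split=> //; exact: MJ.
have [p Mp] := pidR iM; rewrite Mp in Mx M1 maximalM.
have px : divides p x by exact/principal_idealP.
exists p; split=> //; split.
- by apply: contraNneq x0 => p0; case: px => c ->; rewrite p0 mulr0.
- apply/negP => pU; apply: M1; exists p^-1 => //; exact: mulVr.
- move=> a b pab; have [/principal_idealP|npa] := pselect (principal_ideal p a).
    by left.
  (* Multiply the Bezout relation [d * p + c * a = 1] by [b] and use that [p] divides [a * b]. *)
  right; have [_ [c [[d _ <-] e]]] := maximal_ideal_coprime maximalM npa.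
  have [f abf] := pab; exists (b * d + c * f).
  by rewrite mulrDl -mulrA -[c * f * p]mulrA -abf -[b in LHS]mulr1 -e mulrDr;
    congr (_ + _); rewrite mulrCA [b * a]mulrC.
Qed.

(** A generator [k] of a larger ideal satisfies [p = c * k]. If [p] divides [c], then [k] is a unit;
    if [p] divides [k], the two ideals agree. *)
Lemma prime_maximal_ideal p : prime_element p ->
  maximal_ideal (principal_ideal p).
Proof.
move=> [p0 pU pP]; split; first exact: principal_ideal_ideal.
  move=> e; have /principal_idealP/divides_unit : principal_ideal p 1 by rewrite e.
  by rewrite unitr1 (negbTE pU) => /(_ isT).
move=> J iJ pJ; have [k Jk] := pidR iJ.
have [c pck] : divides k p.
  by apply/principal_idealP; rewrite -Jk; apply: pJ; exact: principal_ideal_self.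
have [|[d cd]|pk] := pP c k; first by exists 1; rewrite mul1r pck.
  right; apply: ideal_one => //; rewrite Jk; exists d => //.
  by apply: (mulfI p0); rewrite mulr1 mulrA [p * d]mulrC -cd -pck.
left; apply/seteqP; split=> //; rewrite Jk.
by apply: principal_ideal_sub; [exact: principal_ideal_ideal|exact/principal_idealP].
Qed.

(** Noetherian induction: take a counterexample [y] with [(y)] maximal and split off a prime,
    [y = z * p]. Then [z] is no counterexample, and every prime divisor of [y] divides [z] or is an
    associate of [p]. *)
Lemma finite_prime_classes_dividing x : x != 0 ->
  finite_set (associate_class @` [set p | prime_element p /\ divides p x]).
Proof.
pose D y := associate_class @` [set p : R | prime_element p /\ divides p y].
move=> x0; rewrite -/(D x); apply: contrapT => xD.
pose F := [set I | exists y, [/\ I = principal_ideal y, y != 0 & ~ finite_set (D y)]].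
have [||M [[y [My y0 yD]] maxM]] := @pid_maximal_member R F pidR.
- by move=> _ [y [-> _ _]]; exact: principal_ideal_ideal.
- by exists (principal_ideal x), x.
rewrite {}My in maxM.
have [yU|yU] := boolP (y \is a GRing.unit).
  apply: yD; rewrite [D y](_ : _ = set0) //; apply/seteqP; split=> // q.
  by move=> [p [[_ /negP pU _] py] _]; apply: pU; exact: divides_unit yU.
have [p [pP [z yzp]]] := pid_prime_divisor y0 yU.
have [z0 p0] : z != 0 /\ p != 0.
  by apply/andP; rewrite -negb_or -mulf_eq0 -yzp.
have zD : finite_set (D z).
  (* Otherwise maximality gives [(z) = (y)], so [y] divides [z] and [p] is a unit. *)
  apply: contrapT => zD.
  have zy : divides y z.
    apply/principal_idealP; rewrite -(maxM (principal_ideal z)).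
    + exact: principal_ideal_self.
    + by exists z.
    + apply: principal_ideal_sub; first exact: principal_ideal_ideal.
      by exists p; rewrite // yzp mulrC.
  have [c zc] := zy; have [_ /negP pU _] := pP; apply: pU.
  apply/unitrP; exists c; suff cp : c * p = 1 by rewrite [p * c]mulrC.
  by apply: (mulfI z0); rewrite mulr1 mulrCA -yzp -zc.
apply: yD; apply: (@sub_finite_set _ _ (D z `|` [set associate_class p])).
  move=> _ [q [qP qy] <-]; have [_ _ qprime] := qP.
  move: qy; rewrite yzp => /qprime[qz|qp]; first by left; exists q.
  by right; exact: prime_divides_prime.
by rewrite finite_setU; split=> //; exact: finite_set1.
Qed.

Lemma prime_in_basic (k s : macias R) : prime_element (val s) ->
  macias_basic k s <-> ~ divides (val s) (val k).
Proof.
move=> sP; split=> [/macias_basicP[a [b e]] [c kc]|nsk].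
  have [_ /negP + _] := sP; apply.
  apply: (@divides_unit _ _ 1); last exact: unitr1.
  by exists (a * c + b); rewrite mulrDl -mulrA -kc e.
have [|_ [a [[b _ <-] e]]] :=
    @maximal_ideal_coprime _ _ (val k) (prime_maximal_ideal sP).
  by move/principal_idealP.
by apply/macias_basicP; exists a, b; rewrite addrC.
Qed.

End PrincipalIdealDomain.

(** * The cycle of implications (a), (b), (c), (d), (a) *)

Theorem theorem3p1 (R : idomainType) (pidR : is_pid R)
    (not_field : ~ GRing.field_axiom R) :
  [<-> ~ open [set x : macias R | val x \is a GRing.unit];
       dense [set x : macias R | prime_element (val x)];
       infinite_set (prime_classes R);
       semiprimitive R].
Proof.
have basic_open (k : macias R) : open (macias_basic k).
  by apply/macias_openE; exists [set k]; rewrite bigcup_set1.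
have basic_unit (k s : macias R) : val s \is a GRing.unit -> macias_basic k s.
  by move=> sU; apply/macias_basicP; exists 0, (val s)^-1; rewrite mul0r add0r mulVr.
tfae.
- move=> nopen O [x Ox] /macias_openE[K OK].
  have [k Kk _] : (\bigcup_(k in K) macias_basic k) x by rewrite -OK.
  apply: contrapT => noprime; apply: nopen.
  suff -> : [set x : macias R | val x \is a GRing.unit] = macias_basic k by [].
  apply/seteqP; split=> s; first exact: basic_unit.
  (* A nonunit [s] coprime to [k] has a prime divisor. It is coprime to [k] as well, hence a prime
     in [O]. *)
  move=> /macias_basicP[a [b e]] /=; apply: contrapT => /negP sU.
  have [p [pP [c sc]]] := pid_prime_divisor pidR (valP s) sU.
  have [p0 pU _] := pP; pose q : macias R := exist _ p p0.
  apply: noprime; exists q; split=> //; rewrite OK; exists k => //.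
  apply/(prime_in_basic pidR) => // -[d kd].
  case/negP: pU; apply: (@divides_unit _ _ 1); last exact: unitr1.
  by exists (a * d + b * c); rewrite mulrDl -!mulrA -kd -sc e.
- move=> dP finP.
  (* For such a [k] the basic open set contains 1 but no prime, against density. *)
  suff [k kP] : exists k : macias R, forall p, prime_element p -> divides p (val k).
    have [|s [/(prime_in_basic pidR) sk sP]] := dP _ _ (basic_open k).
      by exists macias1; apply: basic_unit; exact: unitr1.
    by apply: sk => //; exact: kP.
  have /finite_seqP[r rE] := finP.
  have [k kP] : exists k : macias R, forall p, prime_element p ->
      associate_class p \in r -> divides p (val k).
    have {rE} : forall c, c \in r -> prime_classes R c by move=> c cr; rewrite rE.
    (* The witness is the product of one prime from each listed class, starting from 1. *)
    elim: r => [|c r IH] rP; first by exists macias1.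
    have [|k kP] := IH; first by move=> d dr; apply: rP; rewrite inE dr orbT.
    have [q [q0 _ _] qc] := rP c (mem_head _ _).
    exists (exist _ (q * val k) (mulf_neq0 q0 (valP k))) => p pP /=.
    rewrite inE => /orP[/eqP pc|/(kP _ pP) [d ->]]; last first.
      by exists (q * d); rewrite mulrA.
    apply: (@prime_class_divides _ _ q); first by rewrite qc.
    by exists (val k); rewrite mulrC.
  exists k => p pP; apply: kP => //.
  suff : [set` r] (associate_class p) by [].
  by rewrite -rE; exists p.
- move=> infP; apply/seteqP; split=> [x Jx|_ -> M [[]]//].
  (* A nonzero [x] in the radical lies in [(p)] for every prime [p], so every prime class occurs
     among its finitely many. *)
  apply: contrapT => /eqP x0; apply: infP.
  apply: sub_finite_set (finite_prime_classes_dividing pidR x0).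
  move=> _ [p pP <-]; exists p => //; split=> //.
  by apply/principal_idealP; apply: Jx; exact: prime_maximal_ideal.
- move=> J0 /macias_openE[K UK].
  have [k Kk _] : (\bigcup_(k in K) macias_basic k) macias1.
    by rewrite -UK /=; exact: unitr1.
  have kU s : macias_basic k s -> val s \is a GRing.unit.
    move=> ks; have : (\bigcup_(k in K) macias_basic k) s by exists k.
    by rewrite -UK.
  (* A nonzero element coprime only to units lies in every maximal ideal, contradicting (d). *)
  suff : jacobson_radical R (val k) by rewrite J0 => /eqP; rewrite (negbTE (valP k)).
  move=> M maxM; apply: contrapT => Mk.
  have [m [a [Mm e]]] := maximal_ideal_coprime maxM Mk.
  have [iM MT _] := maxM; have [p Mp] := pidR _ iM; move: Mm; rewrite Mp => -[b _ bp].
  (* If [M] is zero, then [k] is a unit, its basic set is everything, and [R] would be a field.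
     Otherwise the generator [p] is coprime to [k], hence a unit, and [M] is improper. *)
  have [p0|p0] := eqVneq p 0.
    apply: not_field => s s0; apply: (kU (exist _ s s0)).
    apply/macias_basicP; exists a, 0.
    by rewrite -e -bp p0 mulr0 mul0r addrC.
  have pU : p \is a GRing.unit.
    apply: (kU (exist _ p p0)); apply/macias_basicP; exists a, b.
    by rewrite -e -bp addrC.
  apply: MT; apply: ideal_one => //; rewrite Mp; exists p^-1 => //; exact: mulVr.
Qed.
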